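(* Let $\alpha\in\{FD,\ DF\}$. For every $n\geq 0$, the number of $\alpha$-equivalence classes of the set $\mathcal{L}_n$ of Łukasiewicz paths of length $n$ is $f_n$, where $f_0=f_1=f_2=1$ and $f_n=f_{n-1}+f_{n-2}$ for $n\geq 3$.
   Context: A Łukasiewicz path of length $n$ is a sequence of $n$ steps from $\{(1,i): i\geq -1\}$ starting at $(0,0)$, ending at $(n,0)$ and never going below the $x$-axis. Write $D=(1,-1)$, $F=(1,0)$, $U_i=(1,i)$ for $i\geq1$. Steps are numbered $1,\dots,n$; an occurrence of a two-step pattern is at position $i$ if its first step is the $i$-th step. Two paths of the same length are $\alpha$-equivalent if the sets of occurrence positions of $\alpha$ in them are identical. *)

(* Defs.v *)
From mathcomp Require Import all_boot all_order all_algebra.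
From mathcomp Require Import mathcomp_extra boolp classical_sets functions cardinality.

Set Implicit Arguments.
Unset Strict Implicit.
Unset Printing Implicit Defensive.

Import Order.TTheory GRing.Theory Num.Theory.

Local Open Scope ring_scope.
Local Open Scope classical_set_scope.

Definition step : Type := (int * int)%type.

Definition is_step (s : step) : bool := (s.1 == 1) && (-1 <= s.2).

Definition stepD : step := (1, -1).
Definition stepF : step := (1, 0).

(* The point reached from the origin after the first k steps of p. *)
Definition vertex (p : seq step) (k : nat) : step := \sum_(s <- take k p) s.

(* Steps are straight segments, so the path stays weakly above the x-axis iff
   all its vertices do. *)
Definition lukasiewicz (n : nat) : set (seq step) :=
  [set p | [/\ size p = n, all is_step p, vertex p n = (n%:Z, 0)
             & forall k : nat, (k <= n)%N -> 0 <= (vertex p k).2]].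

(* Positions are numbered from 1, whereas sequences are indexed from 0. *)
Definition occurrences (alpha p : seq step) : set nat :=
  [set i : nat | (0 < i)%N /\ take (size alpha) (drop i.-1 p) = alpha].

Definition pattern_equiv (alpha p q : seq step) : Prop :=
  size p = size q /\ occurrences alpha p = occurrences alpha q.

Definition equiv_classes (alpha : seq step) (n : nat) : set (set (seq step)) :=
  [set C | exists2 p, lukasiewicz n p
         & C = [set q | lukasiewicz n q /\ pattern_equiv alpha p q]].

Fixpoint fseq (n : nat) : nat :=
  if n is ((_.+1 as n2).+1 as n1).+1 then (fseq n1 + fseq n2)%N else 1%N.

(* Main.v *)
(* A pattern FD or DF cannot occur at position 1, since its D would end below
   the x-axis, and two occurrences cannot be adjacent.  Conversely, any set of
   pairwise non-adjacent positions in {2, ..., n-1} is realised: make the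
   required steps D, all the others F, and compensate with a single first step
   of the right height.  These sets are counted by the Fibonacci recurrence,
   splitting on whether position 2 belongs to the set. *)
Require Import Defs.
From mathcomp Require Import all_boot all_order all_algebra.
From mathcomp Require Import mathcomp_extra boolp classical_sets functions cardinality.
From mathcomp Require Import zify.

Local Open Scope classical_set_scope.
Local Open Scope card_scope.

Import Order.TTheory GRing.Theory Num.Theory.

Lemma card_set_seq (T : eqType) (s : seq T) :
  uniq s -> [set` s] #= `I_(size s).
Proof.
case: s => [|x0 s] us; first by rewrite set_nil II0 card_eq0; apply/eqP.
have -> : [set` x0 :: s] = nth x0 (x0 :: s) @` `I_(size (x0 :: s)).
  apply/seteqP; split=> [y /= /(nthP x0)[i lti <-]|y /= [i lti <-]]; first by exists i.
  exact: mem_nth.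
apply: inj_card_eq => i j; rewrite !inE /= => lti ltj eqij.
by apply/eqP; rewrite -(@nth_uniq _ x0 (x0 :: s)) ?eqij.
Qed.

(** A nonempty fibre determines the value it lies over, so counting classes amounts to counting the
    values of an invariant. *)
Lemma card_fibers (T U : Type) (A : set T) (f : T -> U) :
  [set C | exists2 p, A p & C = [set q | A q /\ f q = f p]] #= f @` A.
Proof.
pose fiber y := [set q | A q /\ f q = y].
have -> : [set C | exists2 p, A p & C = [set q | A q /\ f q = f p]]
        = fiber @` (f @` A).
  apply/seteqP; split=> [C [p Ap ->]|C [_ [p Ap <-] <-]]; last by exists p.
  by exists (f p) => //; exists p.
apply: inj_card_eq => x y; rewrite inE => -[p Ap <-] _ eqC.
by have [] : fiber y p by rewrite -eqC.
Qed.

Definition nonadjacent : rel bool := fun a b => ~~ (a && b).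

(** Strings without two adjacent [true] bits, listed so that the Fibonacci recurrence is visible:
    beyond length 1, a leading [true] forces a [false] after it. *)
Fixpoint sparse_bitseqs (m : nat) : seq bitseq :=
  match m with
  | 0 => [:: [::]]
  | 1 => [:: [:: false]; [:: true]]
  | (m2.+1 as m1).+1 => map (cons false) (sparse_bitseqs m1) ++
                        map (cat [:: true; false]) (sparse_bitseqs m2)
  end.

Lemma sparse_bitseqsSS (m : nat) :
  sparse_bitseqs m.+2 = map (cons false) (sparse_bitseqs m.+1) ++
                        map (cat [:: true; false]) (sparse_bitseqs m).
Proof. by []. Qed.

Lemma nat_ind2 (P : nat -> Prop) :
  P 0 -> P 1 -> (forall m, P m -> P m.+1 -> P m.+2) -> forall m, P m.
Proof.
move=> P0 P1 PSS m; suff [] : P m /\ P m.+1 by [].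
by elim: m => [|m [Pm Pm1]]; split=> //; apply: PSS.
Qed.

Lemma size_sparse_bitseqs (n : nat) : size (sparse_bitseqs (n - 2)) = fseq n.
Proof.
(* Truncated subtraction sends 0, 1 and 2 all to the single empty string, matching the three initial
   values 1 of [fseq]. *)
case: n => [|[|n]] //; rewrite !subSS subn0.
elim/nat_ind2: n => // m IHm IHm1.
by rewrite sparse_bitseqsSS size_cat !size_map IHm IHm1.
Qed.

Lemma mem_sparse_bitseqs (m : nat) (b : bitseq) :
  (b \in sparse_bitseqs m) = (size b == m) && sorted nonadjacent b.
Proof.
elim/nat_ind2: m b => [|[|[] []]|m IHm IHm1 b] //; first by case.
rewrite sparse_bitseqsSS mem_cat; case: b => [|[] b].
- by apply/negP => /orP[] /mapP[].
- have /negbTE -> : true :: b \notin map (cons false) (sparse_bitseqs m.+1).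
    by apply/mapP => -[].
  case: b => [|[] b] /=; rewrite ?andbF.
  + by apply/mapP => -[].
  + by apply/mapP => -[].
  rewrite (mem_map (f := cat [:: true; false])); last by move=> ? ? [].
  by rewrite IHm !eqSS; case: b.
rewrite mem_map; last by move=> ? ? [].
rewrite IHm1 [X in _ || X](_ : _ = false) ?orbF; last by apply/mapP => -[].
by rewrite /= eqSS; case: b.
Qed.

Lemma sparse_bitseqs_uniq (m : nat) : uniq (sparse_bitseqs m).
Proof.
elim/nat_ind2: m => // m IHm IHm1.
rewrite sparse_bitseqsSS cat_uniq !map_inj_uniq ?IHm ?IHm1 ?andbT /=; try by move=> ? ? [].
by apply/hasPn => _ /mapP[b _ ->]; apply/mapP => -[].
Qed.

Definition occ (alpha p : seq step) (i : nat) : bool :=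
  take (size alpha) (drop i p) == alpha.

Lemma occ2P (a b : step) (p : seq step) (i : nat) :
  reflect [/\ (i.+1 < size p)%N, nth 0%R p i = a & nth 0%R p i.+1 = b]
          (occ [:: a; b] p i).
Proof.
rewrite /occ; apply: (iffP eqP) => [eqp|[lti <- <-]].
  have lti : (i.+1 < size p)%N.
    move/(congr1 size): eqp; rewrite size_take size_drop /=.
    by move: (size p) => m; case: ltnP; lia.
  move: eqp; rewrite (drop_nth 0%R (ltnW lti)) (drop_nth 0%R lti) /= take0.
  by case.
by rewrite (drop_nth 0%R (ltnW lti)) (drop_nth 0%R lti) /= take0.
Qed.

(* Bit j records an occurrence at 0-based index j.+1, i.e. at position j + 2. *)
Definition signature (alpha : seq step) (n : nat) (p : seq step) : bitseq :=
  mkseq (fun j => occ alpha p j.+1) (n - 2).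

Section Patterns.

Variable alpha : seq step.
Hypothesis halpha : alpha = [:: stepF; stepD] \/ alpha = [:: stepD; stepF].

Lemma occ_lt (p : seq step) (i : nat) : occ alpha p i -> (i.+1 < size p)%N.
Proof. by case: halpha => -> /occ2P[]. Qed.

(** The step shared by two adjacent occurrences would have to be both F and D. *)
Lemma occ_nonadjacent (p : seq step) (i : nat) :
  nonadjacent (occ alpha p i) (occ alpha p i.+1).
Proof.
by apply/negP => /andP[]; case: halpha => -> /occ2P[_ _ nS] /occ2P[_]; rewrite nS.
Qed.

Lemma vertexS (p : seq step) (k : nat) : (k < size p)%N ->
  vertex p k.+1 = (vertex p k + nth 0 p k)%R.
Proof. by move=> ltk; rewrite /vertex (take_nth 0%R ltk) -cats1 big_cat big_seq1. Qed.

Lemma vertex0 (p : seq step) : vertex p 0 = 0%R.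
Proof. by rewrite /vertex take0 big_nil. Qed.

(** An F and a D in either order, taken from the origin, lead to height -1. *)
Lemma lukasiewicz_occ0 (n : nat) (p : seq step) :
  lukasiewicz n p -> occ alpha p 0 = false.
Proof.
move=> [sp _ _ p_ge0]; apply/negP => occ0.
have := occ_lt _ _ occ0; rewrite sp => lt1n.
have := p_ge0 1%N (ltnW lt1n); have := p_ge0 2%N lt1n.
rewrite !vertexS ?sp ?vertex0 ?(ltnW lt1n) //.
by case: halpha occ0 => -> /occ2P[_ -> ->].
Qed.

Lemma signature_eq (n : nat) (p q : seq step) :
  lukasiewicz n p -> lukasiewicz n q ->
  signature alpha n p = signature alpha n q <-> pattern_equiv alpha p q.
Proof.
move=> Lp Lq; have [[sp _ _ _] [sq _ _ _]] := (Lp, Lq).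
split=> [eqs|[_ eqo]]; last first.
  apply/eq_map => j; apply/idP/idP => /eqP oj.
    by have [_ /eqP] : occurrences alpha q j.+2 by rewrite -eqo; split.
  by have [_ /eqP] : occurrences alpha p j.+2 by rewrite eqo; split.
split; first by rewrite sp sq.
suff eqocc i : occ alpha p i = occ alpha q i.
  apply/seteqP; split=> i [i_gt0 /eqP oi]; split=> //; apply/eqP.
    by rewrite -/(occ _ _ _) -eqocc.
  by rewrite -/(occ _ _ _) eqocc.
case: i => [|j]; first by rewrite !(@lukasiewicz_occ0 n).
have [ltj|lej] := ltnP j (n - 2).
  by move/(congr1 (nth false ^~ j)): eqs; rewrite /signature !nth_mkseq.
(* From index [n - 1] on, a two-step pattern no longer fits, so both sides are false. *)
by apply/idP/idP => /occ_lt; lia.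
Qed.

Lemma signature_sparse (n : nat) (p : seq step) :
  signature alpha n p \in sparse_bitseqs (n - 2).
Proof.
rewrite mem_sparse_bitseqs size_mkseq eqxx /=.
apply/(sortedP false) => i; rewrite size_mkseq => lti.
by rewrite !nth_mkseq ?(ltnW lti) //; apply: occ_nonadjacent.
Qed.

End Patterns.

(** [T] selects the D steps among the indices from 1 on; the initial step rises by their number, so
    that the path returns to height 0. *)
Definition comb_step (n : nat) (T : pred nat) (i : nat) : step :=
  if i == 0 then (1%R, Posz (\sum_(1 <= j < n) T j))
  else if T i then stepD else stepF.

Definition comb (n : nat) (T : pred nat) : seq step := mkseq (comb_step n T) n.

Lemma vertex_comb (n : nat) (T : pred nat) (k : nat) : (k < n)%N ->
  vertex (comb n T) k.+1
  = (Posz k.+1, Posz (\sum_(1 <= j < n) T j) - Posz (\sum_(1 <= j < k.+1) T j))%R.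
Proof.
elim: k => [|k IHk] ltk.
  rewrite vertexS ?size_mkseq // vertex0 nth_mkseq // add0r (@big_geq _ _ _ 1 1) //.
  by rewrite /comb_step /=; congr pair; lia.
rewrite vertexS ?size_mkseq // IHk 1?ltnW // nth_mkseq // [in RHS]big_nat_recr //=.
rewrite /comb_step /=; case: (T k.+1) => /=; congr pair => /=; lia.
Qed.

(** After the first step, the height is the number of D steps still to come, hence nonnegative and
    finally 0. *)
Lemma comb_lukasiewicz (n : nat) (T : pred nat) : lukasiewicz n (comb n T).
Proof.
split.
- exact: size_mkseq.
- apply/allP => _ /mapP[i _ ->]; rewrite /comb_step.
  by case: eqP => // _; case: (T i).
- case: n => [|n]; first by rewrite vertex0.
  by rewrite vertex_comb // subrr.
- case=> [|k] lek; first by rewrite vertex0.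
  rewrite vertex_comb //= subr_ge0 lez_nat.
  by rewrite [leqRHS](@big_cat_nat _ _ _ k.+1) //= leq_addr.
Qed.

Lemma nth_comb (n : nat) (T : pred nat) (i : nat) : (0 < i < n)%N ->
  nth 0%R (comb n T) i = if T i then stepD else stepF.
Proof. by case: i => // i lti; rewrite nth_mkseq. Qed.

Lemma signature_surj (alpha : seq step)
    (halpha : alpha = [:: stepF; stepD] \/ alpha = [:: stepD; stepF])
    (n : nat) (b : bitseq) :
  b \in sparse_bitseqs (n - 2) ->
  exists2 p, lukasiewicz n p & signature alpha n p = b.
Proof.
rewrite mem_sparse_bitseqs => /andP[/eqP sb /(sortedP false) b_sparse].
(* Bit [j] stands for an occurrence at index [j.+1], whose D has index [j.+2] for FD and [j.+1] for
   DF; the padding shifts [b] accordingly. *)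
pose c := if alpha == [:: stepF; stepD] then false :: false :: b else false :: b.
exists (comb n (nth false c)); first exact: comb_lukasiewicz.
apply: (@eq_from_nth _ false); rewrite size_mkseq // => j ltj.
rewrite nth_mkseq //.
have lt1 : (0 < j.+1 < n)%N by lia.
have lt2 : (0 < j.+2 < n)%N by lia.
have nonadj i : nth false b i -> nth false b i.+1 = false.
  (* Past the end of [b] the default [false] applies, which for DF makes the step after a final D an
     F. *)
  have [lti|lei] := ltnP i.+1 (size b); last by rewrite (nth_default _ lei).
  by move=> bi; have := b_sparse _ lti; rewrite /nonadjacent bi => /negbTE.
rewrite {}/c; case: halpha => -> /=.
- apply/occ2P/idP => [[_ _]|bj]; rewrite !nth_comb //=.
    by case: (nth false b j).
  rewrite size_mkseq bj; split=> //.
  (* The step before this D must be F: for [j = 0] it comes from the padding, otherwise from the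
     preceding bit, which sparsity makes [false]. *)
  case: j {ltj lt1 lt2} bj => //= j.
  by case bj : (nth false b j) => //; rewrite nonadj.
- apply/occ2P/idP => [[_ + _]|bj]; rewrite !nth_comb //=.
    by case: (nth false b j).
  by rewrite size_mkseq bj nonadj //; split.
Qed.

Theorem theorem4 (alpha : seq step)
    (halpha : alpha = [:: stepF; stepD] \/ alpha = [:: stepD; stepF]) (n : nat) :
  equiv_classes alpha n #= `I_(fseq n).
Proof.
(* The classes are the fibres of the signature, so it remains to count its image. *)
have -> : equiv_classes alpha n = [set C | exists2 p, lukasiewicz n p &
    C = [set q | lukasiewicz n q /\ signature alpha n q = signature alpha n p]].
  apply/seteqP; split=> C [p Lp ->]; exists p => //;
    apply/seteqP; split=> q [Lq pq]; split=> //.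
  - exact/esym/(signature_eq _ halpha n p q Lp Lq).
  - exact/(signature_eq _ halpha n p q Lp Lq)/esym.
  - exact/(signature_eq _ halpha n p q Lp Lq)/esym.
  - exact/esym/(signature_eq _ halpha n p q Lp Lq).
apply: card_eq_trans (card_fibers _ _ _ _) _.
have -> : signature alpha n @` lukasiewicz n = [set` sparse_bitseqs (n - 2)].
  apply/seteqP; split=> [_ [p _ <-]|b /=]; first exact: signature_sparse.
  by move=> /(signature_surj _ halpha)[p Lp <-]; exists p.
by rewrite -size_sparse_bitseqs; apply/card_set_seq/sparse_bitseqs_uniq.
Qed.
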